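(* For every integer $n\ge 1$ there exist a set $P$ of $3n$ points in general position in the plane and a family $F$ of convex pseudo-discs of $P$ such that no member of $F$ is contained in another and $|F|=\binom{n+1}{2}$.
   Context: A set of points in the plane $\mathbb{R}^2$ is in general position if no three of its points are collinear. Let $\mathrm{conv}(A)$ denote the convex hull of $A$. A family $F$ of subsets of $P$ is called a family of convex pseudo-discs (of $P$) if: (1) every set in $F$ is the intersection of $P$ with a convex set; and (2) if $A$ and $B$ are two different sets in $F$, then both sets $\mathrm{conv}(A)\setminus\mathrm{conv}(B)$ and $\mathrm{conv}(B)\setminus\mathrm{conv}(A)$ are connected (or empty). *)

(* Defs.v *)
From HB Require Import structures.
From mathcomp Require Import all_boot all_order all_algebra finmap.
From mathcomp Require Import all_classical reals topology normedtype convex.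

Set Implicit Arguments.
Unset Strict Implicit.
Unset Printing Implicit Defensive.

Import Order.TTheory GRing.Theory Num.Theory.
Import numFieldNormedType.Exports.

Local Open Scope classical_set_scope.
Local Open Scope ring_scope.

Notation plane R := 'rV[R]_2.

Section PlaneGeometry.
Context {R : realType}.

Definition line (p d : plane R) : set (plane R) :=
  [set x | exists t : R, x = p + t *: d].

Definition collinear (A : set (plane R)) : Prop :=
  exists p d : plane R, d != 0 /\ A `<=` line p d.

Definition general_position (P : {fset plane R}) : Prop :=
  forall a b c, a \in P -> b \in P -> c \in P ->
    a != b -> a != c -> b != c -> ~ collinear [set a; b; c].

Definition conv_hull (A : set (plane R)) : set (plane R) :=
  smallest (@convex_set R (plane R)) A.

(* The first clause makes every member of F a subset of P.  In the second, no
   separate empty case is needed: set0 is connected in the library's sense. *)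
Definition convex_pseudo_discs (P : {fset plane R})
    (F : {fset {fset plane R}}) : Prop :=
  (forall A, A \in F ->
    exists C : set (plane R),
      @convex_set R (plane R) C /\ [set` A] = [set` P] `&` C) /\
  (forall A B, A \in F -> B \in F -> A != B ->
    connected (conv_hull [set` A] `\` conv_hull [set` B]) /\
    connected (conv_hull [set` B] `\` conv_hull [set` A])).

End PlaneGeometry.

(* Main.v *)
Require Import Defs.
From HB Require Import structures.
From mathcomp Require Import all_boot all_order all_algebra finmap.
From mathcomp Require Import all_classical reals topology normedtype convex.
From mathcomp Require Import interval_inference ring lra.

Set Implicit Arguments.
Unset Strict Implicit.
Unset Printing Implicit Defensive.

Import Order.TTheory GRing.Theory Num.Theory.
Import numFieldNormedType.Exports.

Local Open Scope classical_set_scope.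
Local Open Scope ring_scope.

(** Put [n] points on each of three rays leaving the origin, the rays being
    permuted by a linear map of order 3, and for [i + j + k = n - 1] take the
    first [i + 1], [j + 1], [k + 1] points of the three rays: equal sums make
    these binomial(n + 1, 2) sets an antichain.  The hull of each is the
    triangle on its three outermost points, provided the points of a ray stay
    close enough to it; bending the ray into a short arc of a parabola then
    gives general position.  A point of the configuration outside such a
    triangle is separated from it by both sides through the tip on its own ray,
    so two such points always lie beyond a common side, which makes the
    difference of two triangles connected. *)

(** * Convexity and connectedness in the plane *)

Section Convexity.
Context {R : realType}.
Implicit Types (A : set (plane R)) (x y : plane R) (h : plane R -> R).

(** Convexity with an ordinary real coefficient; [convex_setP] ties it to the library's notion,
    whose coefficient carries its bounds in its type. *)
Definition segment_closed A := forall x y (t : R), 0 <= t <= 1 ->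
  A x -> A y -> A (t *: x + (1 - t) *: y).

Lemma convex_setP A : @convex_set R (plane R) A <-> segment_closed A.
Proof.
split=> [cA x y t t01 Ax Ay|cA x y t /set_mem Ax /set_mem Ay].
  by have /set_mem := cA x y (Itv01 (andP t01).1 (andP t01).2) (mem_set Ax) (mem_set Ay).
by apply/mem_set/cA => //; rewrite ge0 le1.
Qed.

Definition affine_map h := forall x y (t : R),
  h (t *: x + (1 - t) *: y) = t * h x + (1 - t) * h y.

Lemma convex_lt0 h : affine_map h -> segment_closed [set x | h x < 0].
Proof. by move=> hA x y t /andP[t0 t1] /= hx hy; rewrite hA; nra. Qed.

Lemma convex_ge0 h : affine_map h -> segment_closed [set x | 0 <= h x].
Proof. by move=> hA x y t /andP[t0 t1] /= hx hy; rewrite hA; nra. Qed.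

Lemma convex_bigcap (I : Type) (F : I -> set (plane R)) :
  (forall i, segment_closed (F i)) -> segment_closed (\bigcap_i F i).
Proof. by move=> FA x y t t01 Fx Fy i _; apply: FA => //; [exact: Fx|exact: Fy]. Qed.

Lemma convex_setI A B :
  segment_closed A -> segment_closed B -> segment_closed (A `&` B).
Proof. by move=> cA cB x y t t01 [? ?] [? ?]; split; [exact: cA|exact: cB]. Qed.

Lemma convex_hull A : segment_closed (conv_hull A).
Proof.
move=> x y t t01 Ax Ay B [cB AB].
by move/convex_setP : (cB); apply => //; [exact: Ax|exact: Ay].
Qed.

Lemma conv_hull_min A B : segment_closed B -> A `<=` B -> conv_hull A `<=` B.
Proof. by move=> /convex_setP; exact: smallest_sub. Qed.

Lemma sub_conv_hull A : A `<=` conv_hull A.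
Proof. exact: sub_gen_smallest. Qed.

(** [A] is the union of the segments joining its points to one fixed point [x], and these all share
    [x]. *)
Lemma convex_connected A : segment_closed A -> connected A.
Proof.
move=> cA; have [->|/set0P[x Ax]] := eqVneq A set0; first exact: connected0.
pose f y (t : R) := t *: x + (1 - t) *: y.
have AE : A = \bigcup_(y in A) (f y @` `[0, 1]).
  apply/seteqP; split=> [y Ay|z [y Ay [t /=]]].
    exists y => //; exists 0; first by rewrite /= in_itv/= lexx ler01.
    by rewrite /f scale0r add0r subr0 scale1r.
  by rewrite in_itv/= => t01 <-; exact: cA.
rewrite AE; apply: bigcup_connected.
  exists x => y Ay; exists 1; first by rewrite /= in_itv/= ler01 lexx.
  by rewrite /f subrr scale0r scale1r addr0.
move=> y Ay; apply: connected_continuous_connected.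
  exact: segment_connected.
apply: continuous_subspaceT => t; apply: cvgD.
  by apply: cvgZr_tmp; exact: cvg_id.
by apply: cvgZr_tmp; apply: cvgB; [exact: cvg_cst|exact: cvg_id].
Qed.

(* Any two points of [A] outside the triangle [B] lie together in one of the
   three open half-planes covering the complement of [B]; the trace of such a
   half-plane on the hull of [A] is convex and disjoint from [B]. *)
Lemma connected_conv_hull_setD A (h : 'I_3 -> plane R -> R) :
  (forall c, affine_map (h c)) ->
  (forall v, A v -> (forall c, 0 <= h c v) \/
    exists c, forall d, d != c -> h d v < 0) ->
  connected (conv_hull A `\` [set x | forall c, 0 <= h c x]).
Proof.
move=> hA Ah; set B := [set x | _]; set D := _ `\` _.
have HD x c : h c x < 0 -> ~ B x by move=> hx /(_ c); rewrite leNgt hx.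
have joined x y c : conv_hull A x -> conv_hull A y -> h c x < 0 -> h c y < 0 ->
    connected_component D x y.
  move=> Ax Ay hx hy.
  exists (conv_hull A `&` [set z | h c z < 0]) => //; split => //.
    by move=> z [Az hz]; split => //; exact: HD hz.
  apply: convex_connected; apply: convex_setI; first exact: convex_hull.
  exact: convex_lt0.
(* A point of the hull with [h c] negative forces some point of [A] there too, since otherwise the
   whole hull would satisfy [0 <= h c]. *)
have seen x : D x -> exists2 v, A v /\ ~ B v & connected_component D x v.
  move=> [Ax] /existsNP[c /negP]; rewrite -ltNge => hx.
  have [v Av hv] : exists2 v, A v & h c v < 0.
    apply: contrapT => nv; suff : 0 <= h c x by rewrite leNgt hx.
    have := conv_hull_min (convex_ge0 (hA c)); apply; last exact: Ax.
    by move=> v Av /=; rewrite leNgt; apply/negP => hv; apply: nv; exists v.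
  exists v; first by split => //; exact: HD hv.
  by apply: joined hx hv => //; exact: sub_conv_hull.
have both v w : A v /\ ~ B v -> A w /\ ~ B w -> connected_component D v w.
  move=> [Av nBv] [Aw nBw].
  have [//|[c vc]] := Ah _ Av; have [//|[d wd]] := Ah _ Aw.
  (* Each of [v] and [w] rules out at most one of the three half-planes, so a common one is left. *)
  have [e ec ed] : exists2 e : 'I_3, e != c & e != d.
    have /card_gt0P[e] : (0 < #|~: [set c; d]|)%N.
      by rewrite cardsCs finset.setCK card_ord cards2; case: (c != d).
    by rewrite !inE negb_or => /andP[]; exists e.
  by apply: (joined _ _ e); [exact: sub_conv_hull|exact: sub_conv_hull|
    exact: vc|exact: wd].
have [->|/set0P[x Dx]] := eqVneq D set0; first exact: connected0.
suff -> : D = connected_component D x by exact: component_connected.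
apply/seteqP; split; last exact: connected_component_sub.
move=> y Dy; have [v vP xv] := seen x Dx; have [w wP yw] := seen y Dy.
apply: connected_component_trans xv _; apply: (connected_component_trans (both _ _ vP wP)).
exact: connected_component_sym.
Qed.

End Convexity.

(** * Orientations, triangles and the rotated parabolic arcs *)

Section Orientation.
Context {R : realType}.
Implicit Types (p q r x y : plane R) (s t u v : R) (c d : 'I_3).

Definition vec s t : plane R := \row_j (if j == 0 then s else t).

Lemma vec0 s t : vec s t 0 0 = s. Proof. by rewrite mxE. Qed.
Lemma vec1 s t : vec s t 0 1 = t. Proof. by rewrite mxE. Qed.

Lemma plane_eq x y : x 0 0 = y 0 0 -> x 0 1 = y 0 1 -> x = y.
Proof.
move=> e0 e1; apply/rowP => -[[|[|//]] i2].
- by rewrite (_ : Ordinal i2 = 0) //; exact: val_inj.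
- by rewrite (_ : Ordinal i2 = 1) //; exact: val_inj.
Qed.

(** Twice the signed area of the triangle [p], [q], [r]. *)
Definition orient p q r : R :=
  (q 0 0 - p 0 0) * (r 0 1 - p 0 1) - (q 0 1 - p 0 1) * (r 0 0 - p 0 0).

Lemma affine_orient p q : affine_map (orient p q).
Proof. by move=> x y t; rewrite /orient !mxE; ring. Qed.

Lemma orient_collinear p q r : collinear [set p; q; r] -> orient p q r = 0.
Proof.
move=> [o [d [_ sub]]].
have [tp ->] : line o d p by apply: sub; left; left.
have [tq ->] : line o d q by apply: sub; left; right.
have [tr ->] : line o d r by apply: sub; right.
by rewrite /orient !mxE; ring.
Qed.

(** The three signed areas spanned by [x] and the sides, divided by the total area [D], are the
    barycentric coordinates of [x]. *)
Lemma conv_hull_triangle (A : set (plane R)) (p : 'I_3 -> plane R) :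
  0 < orient (p 0) (p 1) (p 2) -> (forall c, A (p c)) ->
  (forall x, A x -> forall c, 0 <= orient (p (c + 1)) (p (c + 2)) x) ->
  conv_hull A = [set x | forall c, 0 <= orient (p (c + 1)) (p (c + 2)) x].
Proof.
move=> D0 Ap Ax; apply/seteqP; split.
  apply: conv_hull_min => //.
  have := convex_bigcap (fun c => convex_ge0 (@affine_orient (p (c + 1)) (p (c + 2)))).
  move=> cv x y t t01 hx hy c.
  by apply: (cv x y t t01) => // i _; [exact: hx|exact: hy].
move=> x hx; set D := orient _ _ _ in D0.
have {hx} [h0 h1 h2] : [/\ 0 <= orient (p 1) (p 2) x, 0 <= orient (p 2) (p 0) x &
    0 <= orient (p 0) (p 1) x].
  have [e11 e12] : (1 + 1 : 'I_3) = 2 /\ (1 + 2 : 'I_3) = 0.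
    by split; apply/val_inj.
  have [e21 e22] : (2 + 1 : 'I_3) = 0 /\ (2 + 2 : 'I_3) = 1.
    by split; apply/val_inj.
  have hx0 := hx 0; have hx1 := hx 1; have hx2 := hx 2.
  rewrite !add0r in hx0; rewrite e11 e12 in hx1; rewrite e21 e22 in hx2.
  by split; [exact: hx0|exact: hx1|exact: hx2].
have DE : D = orient (p 1) (p 2) x + orient (p 2) (p 0) x + orient (p 0) (p 1) x.
  by rewrite /D /orient; ring.
have cmb (a b e : R) q r o : 0 <= a -> 0 <= b -> 0 <= e -> a + b + e = 1 ->
    conv_hull A q -> conv_hull A r -> conv_hull A o ->
    conv_hull A (a *: q + b *: r + e *: o).
  (* The three-point combination is nested into two binary ones; this divides by [b + e = 1 - a],
     hence the separate case [a = 1]. *)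
  move=> a0 b0 e0 abe Aq Ar Ao; have [a1|a1] := eqVneq a 1.
    have -> : b = 0 by lra.
    have -> : e = 0 by lra.
    by rewrite a1 !scale0r !addr0 scale1r.
  have a2 : 0 < b + e by rewrite lt_neqAle addr_ge0// andbT eq_sym; apply/eqP => be;
    move/eqP: a1; apply; lra.
  have -> : a *: q + b *: r + e *: o = a *: q + (1 - a) *:
      ((b / (b + e)) *: r + (1 - b / (b + e)) *: o).
    have -> : 1 - a = b + e by lra.
    rewrite scalerDr !scalerA addrA; congr (_ + _ *: _ + _ *: _); field; lra.
  apply: convex_hull => //; first lra.
  apply: convex_hull => //.
  by rewrite divr_ge0 ?ler_pdivrMr ?mul1r ?lerDl ?addr_ge0.
have DK (u v : R) : u / D * v * D = u * v by rewrite mulrAC divfK ?(lt0r_neq0 D0).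
have -> : x = (orient (p 1) (p 2) x / D) *: p 0 + (orient (p 2) (p 0) x / D) *: p 1
    + (orient (p 0) (p 1) x / D) *: p 2.
  by apply: plane_eq; rewrite !mxE; apply: (mulIf (lt0r_neq0 D0));
    rewrite !mulrDl !DK /D /orient; ring.
apply: cmb; try (by apply: divr_ge0 => //; exact: ltW); try exact: sub_conv_hull.
rewrite -!mulrDl -DE divff//; exact: lt0r_neq0.
Qed.

(** A rotation by 120 degrees in skew coordinates: it sends (1,0) to (0,1), then to (-1,-1), then
    back, and has determinant 1, so it preserves [orient]. *)
Definition rot p : plane R := vec (- p 0 1) (p 0 0 - p 0 1).

Lemma rot3 p : rot (rot (rot p)) = p.
Proof. by apply: plane_eq; rewrite /rot !(vec0, vec1); ring. Qed.

Lemma orient_rot p q r : orient (rot p) (rot q) (rot r) = orient p q r.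
Proof. by rewrite /orient /rot !(vec0, vec1); ring. Qed.

(** For [s] in [1,2] the factor 1/32 keeps the ordinate at most 1/8, small enough for the
    orientations below to have the same signs as on straight rays. *)
Definition arc s : plane R := vec s (s ^+ 2 / 32).

(** Indexing the arcs by ['I_3] turns addition modulo 3 into composition of rotations. *)
Definition pt c s : plane R := iter c rot (arc s).

Lemma pt_shift c d s : pt (c + d) s = iter c rot (pt d s).
Proof.
by case: c => -[|[|[|//]]] ?; case: d => -[|[|[|//]]] ?; rewrite /pt /= ?rot3.
Qed.

Lemma orient_shift c d1 d2 d3 s1 s2 s3 :
  orient (pt (c + d1) s1) (pt (c + d2) s2) (pt (c + d3) s3) =
  orient (pt d1 s1) (pt d2 s2) (pt d3 s3).
Proof. by rewrite !pt_shift; elim: (val c) => //= k IH; rewrite orient_rot. Qed.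

Lemma orient_arc s t u :
  orient (arc s) (arc t) (arc u) = (t - s) * (u - s) * (u - t) / 32.
Proof. by rewrite /orient /arc !(vec0, vec1); field. Qed.

Lemma orient_arc_tips s u v : 1 <= s <= 2 -> 1 <= u <= 2 -> 1 <= v <= 2 ->
  0 < orient (arc s) (rot (arc u)) (rot (rot (arc v))).
Proof.
move=> s12 u12 v12; rewrite /orient /arc /rot !(vec0, vec1).
have sq (x : R) : 1 <= x <= 2 -> 0 <= x ^+ 2 / 32 <= 1 / 8 by nra.
move: (sq _ s12) (sq _ u12) (sq _ v12).
(* The orientation becomes [(b + s) * (v + a) + (u - a - b) * (v + s - c)], where all four factors
   are positive. *)
move: (s ^+ 2 / 32) (u ^+ 2 / 32) (v ^+ 2 / 32) => a b c a8 b8 c8; nra.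
Qed.

Lemma orient_arc_next s s' u : 1 <= s <= 2 -> 1 <= s' <= 2 -> 1 <= u <= 2 ->
  exists2 k, 0 < k & orient (arc s) (rot (arc u)) (arc s') = (s - s') * k.
Proof.
move=> s12 s12' u12.
(* The quotient by [s - s']: on a straight ray it would be [u >= 1], and bending lowers it by at
   most 1/4. *)
exists ((u ^+ 2 / 32 + s) * (s + s') / 32 + u - u ^+ 2 / 32 - s ^+ 2 / 32).
  have sq (x : R) : 1 <= x <= 2 -> 0 <= x ^+ 2 / 32 <= 1 / 8 by nra.
  move: (sq _ s12) (sq _ u12); move: (s ^+ 2 / 32) (u ^+ 2 / 32) => a b a8 b8; nra.
by rewrite /orient /arc /rot !(vec0, vec1); field.
Qed.

Lemma orient_arc_prev s s' v : 1 <= s <= 2 -> 1 <= s' <= 2 -> 1 <= v <= 2 ->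
  exists2 k, 0 < k & orient (rot (rot (arc v))) (arc s) (arc s') = (s - s') * k.
Proof.
move=> s12 s12' v12.
(* Here the straight value is [v >= 1], and bending lowers it by at most 1/2. *)
exists (s ^+ 2 / 32 + v - (s + v - v ^+ 2 / 32) * (s + s') / 32).
  have sq (x : R) : 1 <= x <= 2 -> 0 <= x ^+ 2 / 32 <= 1 / 8 by nra.
  move: (sq _ s12) (sq _ v12); move: (s ^+ 2 / 32) (v ^+ 2 / 32) => a b a8 b8; nra.
by rewrite /orient /arc /rot !(vec0, vec1); field.
Qed.

(** After rotating the first point to arc 0, three points share an arc (a Vandermonde product), or
    exactly two do (a nonzero parameter difference times a positive factor), or none do (the tips of
    a proper triangle). *)
Lemma orient_pt_neq0 c1 c2 c3 s1 s2 s3 :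
  1 <= s1 <= 2 -> 1 <= s2 <= 2 -> 1 <= s3 <= 2 ->
  (c1, s1) != (c2, s2) -> (c1, s1) != (c3, s3) -> (c2, s2) != (c3, s3) ->
  orient (pt c1 s1) (pt c2 s2) (pt c3 s3) != 0.
Proof.
move=> b1 b2 b3 n12 n13 n23.
have shift d : d = c1 + (d - c1) by rewrite addrC subrK.
rewrite -(addr0 c1) (shift c2) (shift c3) orient_shift.
move: n12 n13 n23; rewrite !xpair_eqE.
rewrite -(inj_eq (addIr (- c1)) c1 c2) -(inj_eq (addIr (- c1)) c1 c3).
rewrite -(inj_eq (addIr (- c1)) c2 c3) subrr.
have perm1 p q r : orient p q r = orient q r p by rewrite /orient; ring.
have perm2 p q r : orient p q r = - orient q p r by rewrite /orient; ring.
have next s s' u : 1 <= s <= 2 -> 1 <= s' <= 2 -> 1 <= u <= 2 -> s != s' ->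
    orient (arc s) (rot (arc u)) (arc s') != 0.
  move=> sb sb' ub ss'; have [k k0 ->] := orient_arc_next sb sb' ub.
  by apply: mulf_neq0; [rewrite subr_eq0|exact: lt0r_neq0].
have prev s s' v : 1 <= s <= 2 -> 1 <= s' <= 2 -> 1 <= v <= 2 -> s != s' ->
    orient (rot (rot (arc v))) (arc s) (arc s') != 0.
  move=> sb sb' vb ss'; have [k k0 ->] := orient_arc_prev sb sb' vb.
  by apply: mulf_neq0; [rewrite subr_eq0|exact: lt0r_neq0].
have tips s u v : 1 <= s <= 2 -> 1 <= u <= 2 -> 1 <= v <= 2 ->
    orient (arc s) (rot (arc u)) (rot (rot (arc v))) != 0.
  by move=> sb ub vb; exact/lt0r_neq0/orient_arc_tips.
move: (c2 - c1) (c3 - c1) => -[[|[|[|//]]] ?] -[[|[|[|//]]] ?];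
  rewrite /pt /= => n12 n13 n23.
- by rewrite orient_arc !mulf_neq0// subr_eq0 eq_sym.
- by rewrite perm1 next // eq_sym.
- by rewrite -perm1 prev.
- by rewrite next.
- by rewrite -2!orient_rot !rot3 prev.
- by rewrite tips.
- by rewrite perm2 oppr_eq0 prev.
- by rewrite perm1 perm2 oppr_eq0 -perm1 tips.
- by rewrite -orient_rot !rot3 perm1 perm1 next // eq_sym.
Qed.

(** Two coinciding points with different labels would span zero area with any point of a further
    arc, against [orient_pt_neq0]. *)
Lemma pt_inj c c' s s' : 1 <= s <= 2 -> 1 <= s' <= 2 ->
  pt c s = pt c' s' -> (c, s) = (c', s').
Proof.
move=> sb sb' e; apply/eqP; apply: contraT => ne.
have [d dc dc'] : exists2 d : 'I_3, d != c & d != c'.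
  have /card_gt0P[d] : (0 < #|~: [set c; c']|)%N.
    by rewrite cardsCs finset.setCK card_ord cards2; case: (c != c').
  by rewrite !inE negb_or => /andP[]; exists d.
have one2 : 1 <= (1 : R) <= 2 by rewrite lexx ler1n.
have := @orient_pt_neq0 c c' d s s' 1 sb sb' one2 ne.
rewrite !xpair_eqE ![_ == d]eq_sym (negPf dc) (negPf dc') => /(_ isT isT)/eqP[].
by rewrite e /orient; ring.
Qed.

(* Positive on the inner side of the edge opposite to the tip [pt c (w c)]. *)
Definition side (w : 'I_3 -> R) c : plane R -> R :=
  orient (pt (c + 1) (w (c + 1))) (pt (c + 2) (w (c + 2))).

Lemma side_opposite (w : 'I_3 -> R) c s : (forall d, 1 <= w d <= 2) ->
  1 <= s <= 2 -> 0 < side w c (pt c s).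
Proof.
move=> wb sb; rewrite /side -{5}(addr0 c) orient_shift /pt /=.
by rewrite -2!orient_rot !rot3; exact: orient_arc_tips.
Qed.

(** On the two arcs that the side joins, the sign only tells whether the point comes before or after
    the tip. *)
Lemma side_adjacent (w : 'I_3 -> R) c d s : (forall e, 1 <= w e <= 2) ->
  1 <= s <= 2 -> d != c ->
  exists2 k, 0 < k & side w c (pt d s) = (w d - s) * k.
Proof.
move=> wb sb dc.
have [->|->] : d = c + 1 \/ d = c + 2.
  case: c d dc => -[|[|[|//]]] ? [[|[|[|//]]] ?] //= _;
    ((by left; apply/val_inj) || (by right; apply/val_inj)).
- rewrite /side orient_shift /pt /= -2!orient_rot !rot3.
  exact: orient_arc_next.
- rewrite /side orient_shift /pt /= -orient_rot !rot3.
  exact: orient_arc_prev.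
Qed.

End Orientation.

(** * The configuration *)

Section Configuration.
Context {R : realType} (m : nat).
Local Notation index := ('I_3 * 'I_m.+1)%type.
Local Notation triple := (3.-tuple 'I_m.+1).
Implicit Types (t u : triple) (x : index).

(** Equally spaced parameters within [1,2], the range of the sign estimates. *)
Definition param (i : 'I_m.+1) : R := 1 + i%:R / m.+1%:R.

Lemma param_bounds i : 1 <= param i <= 2.
Proof.
rewrite /param lerDl divr_ge0//= -[leRHS]/(1 + 1) lerD2l.
by rewrite ler_pdivrMr ?mul1r ?ler_nat ?ltr0n// ltnW.
Qed.

Lemma ler_param i j : (param i <= param j) = (i <= j)%N.
Proof. by rewrite /param lerD2l ler_pM2r ?invr_gt0 ?ltr0n// ler_nat. Qed.

Lemma param_inj : injective param.
Proof.
by move=> i j e; apply/val_inj/eqP; rewrite eqn_leq -!ler_param e lexx.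
Qed.

Definition point x : plane R := pt x.1 (param x.2).

Lemma point_inj : injective point.
Proof.
move=> [c i] [d j] /(pt_inj (param_bounds i) (param_bounds j)) [-> /param_inj ->].
by [].
Qed.

Definition points : {fset plane R} := [fset point x | x in {: index}]%fset.

(** Entry [c] of [t] is the 0-based position of the outermost chosen point on arc [c], so the
    comparison is not strict. *)
Definition below t x := (x.2 <= tnth t x.1)%N.

Definition disc t : {fset plane R} :=
  [fset point x | x in [pred x : index | below t x]]%fset.

Definition discs : {fset {fset plane R}} :=
  [fset disc t | t in [pred t : triple | (\sum_(i <- t) i == m)%N]]%fset.

Definition tip t c : R := param (tnth t c).

Lemma tip_bounds t c : 1 <= tip t c <= 2.
Proof. exact: param_bounds. Qed.

Lemma mem_disc t x : (point x \in disc t) = below t x.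
Proof.
apply/imfsetP/idP => [[y /= yt /point_inj ->] //|xt].
by exists x.
Qed.

Lemma side_below t x c : below t x -> 0 <= side (tip t) c (point x).
Proof.
case: x => d i; rewrite /below /= => it.
have [->|dc] := eqVneq d c.
  exact/ltW/side_opposite/param_bounds/tip_bounds.
have [k k0 ->] := side_adjacent (tip_bounds t) (param_bounds i) dc.
by rewrite mulr_ge0 ?subr_ge0 ?ler_param// ltW.
Qed.

Lemma side_above t x c : ~~ below t x -> c != x.1 ->
  side (tip t) c (point x) < 0.
Proof.
case: x => d i; rewrite /below /= -ltnNge => it; rewrite eq_sym => dc.
have [k k0 ->] := side_adjacent (tip_bounds t) (param_bounds i) dc.
by rewrite pmulr_llt0// subr_lt0 ltNge ler_param -ltnNge.
Qed.

(** * Hulls of the discs and their differences *)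

Lemma conv_hull_disc t :
  conv_hull [set` disc t] = [set y | forall c, 0 <= side (tip t) c y].
Proof.
apply: (conv_hull_triangle (p := fun c => pt c (tip t c))).
- exact: orient_arc_tips (tip_bounds t 0) (tip_bounds t 1) (tip_bounds t 2).
- by move=> c /=; rewrite (mem_disc t (c, tnth t c)) /below /=.
- by move=> y /= /imfsetP[x /= xt ->] c; exact: side_below.
Qed.

(** A point past the tip of its arc is strictly beyond either side through that tip; side [x.1 + 1]
    is one of them. *)
Lemma conv_hull_point t x : conv_hull [set` disc t] (point x) -> below t x.
Proof.
rewrite conv_hull_disc /= => h; apply: contraT => xt.
have := side_above (c := x.1 + 1) xt; rewrite ltNge h => /(_ _)/= H; apply: H.
by case: (x.1) => -[|[|[|]]].
Qed.

Lemma connected_discD t u :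
  connected (conv_hull [set` disc t] `\` conv_hull [set` disc u]).
Proof.
rewrite (conv_hull_disc u); apply: connected_conv_hull_setD.
  by move=> c; exact: affine_orient.
move=> v /imfsetP[x /= _ ->]; have [xu|xu] := boolP (below u x).
  by left=> c; exact: side_below.
(* Only the side opposite to the arc of [x] may fail to separate it from the triangle. *)
by right; exists x.1 => d; exact: side_above.
Qed.

(** * Antichain property, counting and conclusion *)

Lemma disc_sub t u : (disc t `<=` disc u)%fset ->
  forall c, (tnth t c <= tnth u c)%N.
Proof.
move=> /fsubsetP tu c.
by have := tu (point (c, tnth t c)); rewrite !mem_disc /below /= leqnn; exact.
Qed.

(** Inclusion compares the triples entrywise, and one strict inequality would make the sums
    differ. *)
Lemma disc_sub_eq t u : (\sum_(i <- t) i = \sum_(i <- u) i)%N ->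
  (disc t `<=` disc u)%fset -> t = u.
Proof.
rewrite !big_tuple => e /disc_sub tu; apply: eq_from_tnth => c.
apply/val_inj/eqP; rewrite eqn_leq tu /=.
rewrite leqNgt; apply/negP => lt.
have : (\sum_(i < 3) tnth t i < \sum_(i < 3) tnth u i)%N.
  rewrite (bigD1 c) //= [X in (_ < X)%N](bigD1 c) //= -addSn.
  by apply: leq_add => //; apply: leq_sum.
by rewrite e ltnn.
Qed.

Lemma card_points : #|` points| = (3 * m.+1)%N.
Proof.
by rewrite card_imfset /=; [rewrite -cardE card_prod !card_ord|exact: point_inj].
Qed.

Lemma card_discs : #|` discs| = 'C(m.+2, 2).
Proof.
rewrite card_in_imfset /=; last first.
  move=> t u /eqP st /eqP su e; apply: disc_sub_eq; first by rewrite st.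
  by rewrite e.
(* Stars and bars: triples of naturals with sum [m]; the bound [m] on each entry then excludes
   none. *)
rewrite -[RHS](card_ord_partitions 2 m) -cardE.
by apply: eq_card => t; rewrite !inE.
Qed.

Lemma points_general : general_position points.
Proof.
move=> a b c /imfsetP[x _ ->] /imfsetP[y _ ->] /imfsetP[z _ ->].
rewrite !(inj_eq point_inj); case: x y z => [d i] [e j] [f k] xy xz yz.
move=> /orient_collinear/eqP; apply/negP.
by apply: orient_pt_neq0; rewrite ?param_bounds// xpair_eqE (inj_eq param_inj).
Qed.

Lemma points_discs : convex_pseudo_discs points discs.
Proof.
split=> [A /imfsetP[t _ ->]|A B /imfsetP[t _ ->] /imfsetP[u _ ->] _].
  (* The hull of the disc is the convex set cutting it out: by [conv_hull_point] it contains no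
     further point of the configuration. *)
  exists (conv_hull [set` disc t]); split; first by apply/convex_setP; exact: convex_hull.
  apply/seteqP; split=> y /=.
    move=> yt; split; last exact: sub_conv_hull.
    by case/imfsetP: yt => x _ ->; apply/imfsetP; exists x.
  by move=> [/imfsetP[x _ ->]] /conv_hull_point; rewrite -mem_disc.
by split; exact: connected_discD.
Qed.

Lemma discs_antichain A B :
  A \in discs -> B \in discs -> A != B -> ~~ (A `<=` B)%fset.
Proof.
move=> /imfsetP[t /eqP st ->] /imfsetP[u /eqP su ->]; apply: contra => tu.
by apply/eqP; congr disc; apply: disc_sub_eq tu; rewrite st.
Qed.

End Configuration.

Theorem mainTheorem3 (R : realType) (n : nat) (hn : (1 <= n)%N) :
  exists (P : {fset plane R}) (F : {fset {fset plane R}}),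
    [/\ #|` P| = (3 * n)%N,
        general_position P,
        convex_pseudo_discs P F,
        (forall A B, A \in F -> B \in F -> A != B -> ~~ (A `<=` B)%fset)
      & #|` F| = 'C(n.+1, 2)].
Proof.
(* With [n = m + 1], the triples sum to [n - 1 = m]. *)
case: n hn => // m _; exists (points m), (discs m); split.
- exact: card_points.
- exact: points_general.
- exact: points_discs.
- exact: discs_antichain.
- exact: card_discs.
Qed.
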